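(* For a subfit frame $L$, the following are equivalent. \begin{enumerate} \item The frame $L$ is scattered. \item $\mathsf{Filt}_{\mathcal{SE}}(L)=\mathsf{Filt}_{\mathcal{E}}(L)=\mathsf{Filt}_{\mathcal{R}}(L)$. \item $\mathsf{Filt}_{\mathcal{SE}}(L)=\mathsf{Filt}_{\mathcal{E}}(L)$. \item The frame $L$ has a unique Raney extension, up to isomorphism. \item $\mathsf{S}_{\mathfrak{o}}(L)=\mathsf{S}_{\mathfrak{c}}(L)$. \item The frame $L$ has a unique Raney extension, up to isomorphism, and this is $(L,\mathsf{S}(L))$, where $a\in L$ is identified with the open sublocale $\mathfrak{o}(a)$. \end{enumerate}
   Context: A frame $L$ is subfit if whenever $x\not\le y$ in $L$ there is $u\in L$ with $x\vee u=1$ and $y\vee u\neq 1$. A sublocale of $L$ is a subset $S\subseteq L$ closed under all meets and such that $x\to s\in S$ for all $x\in L$, $s\in S$. $\mathsf{S}(L)$ is the coframe of all sublocales ordered by inclusion. The open and closed sublocales associated with $a\in L$ are $\mathfrak{o}(a)=\{a\to b:b\in L\}$ and $\mathfrak{c}(a)={\uparrow}a$. $\mathsf{S}_{\mathfrak{o}}(L)\subseteq\mathsf{S}(L)$ is the collection of intersections of open sublocales (fitted sublocales), and $\mathsf{S}_{\mathfrak{c}}(L)\subseteq\mathsf{S}(L)$ that of joins of closed sublocales. $L$ is scattered if $\mathsf{S}(L)$ is Boolean. A meet $\bigwedge_i x_i$ in $L$ is exact if $(\bigwedge_i x_i)\vee a=\bigwedge_i(x_i\vee a)$ for all $a\in L$;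 it is strongly exact if for all $y\in L$, $x_i\to y=y$ for all $i$ implies $(\bigwedge_i x_i)\to y=y$. $\mathsf{Filt}_{\mathcal{E}}(L)$ and $\mathsf{Filt}_{\mathcal{SE}}(L)$ are the collections of filters closed under exact, respectively strongly exact, meets. $\mathsf{Filt}_{\mathcal{R}}(L)$ is the collection of regular filters, i.e. those of the form $F\to\{1\}$ in the frame of all filters of $L$ ordered by inclusion; equivalently, intersections of filters of the form $\{x\in L:x\vee a=1\}$, $a\in L$. A Raney extension is a pair $(L,C)$ where $C$ is a coframe, $L\subseteq C$ is a frame such that every element of $C$ is a meet of elements of $L$, and the inclusion preserves arbitrary joins, finite meets, and strongly exact meets of $L$. A morphism $f:(L,C)\to(M,D)$ is a coframe map $f:C\to D$ (preserving arbitrary meets and finite joins) with $f[L]\subseteq M$ restricting to a frame map $L\to M$; isomorphisms are taken in this category. *)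

(* Defs.v *)
From HB Require Import structures.
From mathcomp Require Import all_boot all_order.
From mathcomp Require Import boolp classical_sets.

Set Implicit Arguments.
Unset Strict Implicit.
Unset Printing Implicit Defensive.

Import Order.TTheory.
Local Open Scope classical_set_scope.
Local Open Scope order_scope.

HB.mixin Record TBLattice_isComplete d T of Order.TBLattice d T := {
  ex_supremums : forall A : set T, supremums A !=set0
}.

#[short(type="completeLatticeType")]
HB.structure Definition CompleteLattice d :=
  {T of Order.TBLattice d T & TBLattice_isComplete d T}.

(* The values \bot and \top cover the empty set, for which [supremum] and
   [infimum] return their default argument. *)
Definition bigjoin d (T : completeLatticeType d) (A : set T) : T :=
  supremum \bot A.
Definition bigmeet d (T : completeLatticeType d) (A : set T) : T :=
  infimum \top A.

HB.factory Record POrder_isComplete d T of Order.POrder d T := {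
  ex_infimums : forall A : set T, infimums A !=set0
}.

HB.builders Context d T of POrder_isComplete d T.

Let inf (A : set T) : T := projT1 (cid (ex_infimums A)).

Let inf_lb A x : A x -> inf A <= x.
Proof. by rewrite /inf; case: cid => y /= [lb _]; apply: lb. Qed.

Let inf_glb A y : (forall x, A x -> y <= x) -> y <= inf A.
Proof. by rewrite /inf; case: cid => z /= [_ glb] h; apply: glb. Qed.

Let meet x y := inf [set x; y].
Let join x y := inf [set z | x <= z /\ y <= z].

Let lexI x y z : (x <= meet y z) = (x <= y) && (x <= z).
Proof.
apply/idP/andP => [h|[xy xz]]; last by apply: inf_glb => _ [] ->.
by split; apply: le_trans h _; apply: inf_lb; [left|right].
Qed.

Let leUx x y z : (join x y <= z) = (x <= z) && (y <= z).
Proof.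
apply/idP/andP => [h|[xz yz]]; last exact: inf_lb.
by split; apply: le_trans _ h; apply: inf_glb => w [].
Qed.

HB.instance Definition _ := Order.POrder_MeetJoin_isLattice.Build d T lexI leUx.

Let bot_le x : inf setT <= x. Proof. exact: inf_lb. Qed.
Let le_top x : x <= inf set0. Proof. by apply: inf_glb. Qed.

HB.instance Definition _ := Order.hasBottom.Build d T bot_le.
HB.instance Definition _ := Order.hasTop.Build d T le_top.

Let ex_sup (A : set T) : supremums A !=set0.
Proof.
exists (inf (ubound A)); split=> [x Ax|y ubA]; last exact: inf_lb.
by apply: inf_glb => y; apply.
Qed.

HB.instance Definition _ := TBLattice_isComplete.Build d T ex_sup.

HB.end.

Section CompleteLatticeTheory.
Context d (T : completeLatticeType d).
Implicit Types (A : set T) (x y : T).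

Lemma bigjoinP A : supremums A (bigjoin A).
Proof.
rewrite /bigjoin /supremum; case: ifPn => [/eqP ->|_].
  by split=> // x _; apply: le0x.
by have [z Az] := ex_supremums A; case: xgetP => [w _ //|/(_ z)].
Qed.

Lemma bigjoin_ub A x : A x -> x <= bigjoin A.
Proof. by move=> Ax; apply: (bigjoinP A).1. Qed.

Lemma bigjoin_lub A y : (forall x, A x -> x <= y) -> bigjoin A <= y.
Proof. by move=> h; apply: (bigjoinP A).2. Qed.

Lemma bigmeetP A : infimums A (bigmeet A).
Proof.
rewrite /bigmeet /infimum; case: ifPn => [/eqP ->|_].
  by split=> // x _; apply: lex1.
case: xgetP => [w _ //|/(_ (bigjoin (lbound A)))]; case.
by split=> [x Ax|y lby]; [apply: bigjoin_lub => y; apply|apply: bigjoin_ub].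
Qed.

Lemma bigmeet_lb A x : A x -> bigmeet A <= x.
Proof. by move=> Ax; apply: (bigmeetP A).1. Qed.

Lemma bigmeet_glb A y : (forall x, A x -> y <= x) -> y <= bigmeet A.
Proof. by move=> h; apply: (bigmeetP A).2. Qed.

End CompleteLatticeTheory.

HB.mixin Record CompleteLattice_isFrame d T of CompleteLattice d T := {
  meet_bigjoin : forall (x : T) (A : set T),
    x `&` bigjoin A = bigjoin [set x `&` a | a in A]
}.

#[short(type="frameType")]
HB.structure Definition Frame d :=
  {T of CompleteLattice d T & CompleteLattice_isFrame d T}.

HB.mixin Record CompleteLattice_isCoframe d T of CompleteLattice d T := {
  join_bigmeet : forall (x : T) (A : set T),
    x `|` bigmeet A = bigmeet [set x `|` a | a in A]
}.

#[short(type="coframeType")]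
HB.structure Definition Coframe d :=
  {T of CompleteLattice d T & CompleteLattice_isCoframe d T}.

Definition frame_map d d' (L : frameType d) (M : frameType d') (f : L -> M) :=
  [/\ forall A : set L, f (bigjoin A) = bigjoin (f @` A),
      f \top = \top & {morph f : x y / x `&` y}].

Definition coframe_map d d' (C : coframeType d) (D : coframeType d')
    (f : C -> D) :=
  [/\ forall A : set C, f (bigmeet A) = bigmeet (f @` A),
      f \bot = \bot & {morph f : x y / x `|` y}].

Definition boolean_lattice d (T : tbLatticeType d) :=
  @left_distributive T T Order.meet Order.join /\
  forall x : T, exists y : T, x `&` y = \bot /\ x `|` y = \top.

Section Heyting.
Context d (L : frameType d).
Implicit Types (x y z : L) (A : set L).

Definition imp x y : L := bigjoin [set z | z `&` x <= y].

Lemma le_imp z x y : (z <= imp x y) = (z `&` x <= y).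
Proof.
apply/idP/idP => [zi|]; last exact: bigjoin_ub.
apply: le_trans (leI2 zi (lexx x)) _; rewrite meetC meet_bigjoin.
by apply: bigjoin_lub => _ [w /= wxy <-]; rewrite meetC.
Qed.

Lemma imp_uncurry x y z : imp x (imp y z) = imp (x `&` y) z.
Proof.
apply/le_anti/andP; split; first by rewrite le_imp meetA -!le_imp.
by rewrite !le_imp -meetA -le_imp.
Qed.

Lemma imp_meetr x y z : imp x (y `&` z) = imp x y `&` imp x z.
Proof.
apply/le_anti/andP; split.
  by rewrite lexI [X in X && _]le_imp [X in _ && X]le_imp -lexI -le_imp.
by rewrite le_imp lexI -le_imp leIl -le_imp leIr.
Qed.

Lemma imp_bigmeet x A : imp x (bigmeet A) = bigmeet (imp x @` A).
Proof.
apply/le_anti/andP; split.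
  apply: bigmeet_glb => _ [a Aa <-]; rewrite le_imp.
  by apply: le_trans (bigmeet_lb Aa); rewrite -le_imp.
rewrite le_imp; apply: bigmeet_glb => a Aa; rewrite -le_imp.
by apply: bigmeet_lb; exists a.
Qed.

Definition subfit :=
  forall x y, ~~ (x <= y) -> exists u, x `|` u = \top /\ y `|` u <> \top.

Definition exact_meet A :=
  forall a, bigmeet A `|` a = bigmeet [set x `|` a | x in A].

Definition strongly_exact_meet A :=
  forall y, (forall x, A x -> imp x y = y) -> imp (bigmeet A) y = y.

End Heyting.
Arguments subfit {d} L.

(* Lattice filters are not required to be proper. *)
Section Filters.
Context d (L : frameType d).
Implicit Types F G H : set L.

Definition lattice_filter F :=
  [/\ F \top, (forall x y, F x -> x <= y -> F y) &
      (forall x y, F x -> F y -> F (x `&` y))].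

Definition Filt_E : set (set L) :=
  [set F | lattice_filter F /\
           forall A, A `<=` F -> exact_meet A -> F (bigmeet A)].

Definition Filt_SE : set (set L) :=
  [set F | lattice_filter F /\
           forall A, A `<=` F -> strongly_exact_meet A -> F (bigmeet A)].

(* The last clause says that H is the Heyting implication F -> {1} in the
   frame of filters, whose binary meets are intersections. *)
Definition Filt_R : set (set L) :=
  [set H | lattice_filter H /\ exists F, lattice_filter F /\
           forall G, lattice_filter G ->
             (G `<=` H <-> (G `&` F)%classic `<=` [set \top])].

End Filters.
Arguments Filt_E {d} L.
Arguments Filt_SE {d} L.
Arguments Filt_R {d} L.

(* Taking A empty shows that a sublocale contains \top. *)
Definition is_sublocale d (L : frameType d) (S : set L) :=
  (forall A, A `<=` S -> S (bigmeet A)) /\ (forall x s, S s -> S (imp x s)).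

Record sublocale d (L : frameType d) := Sublocale {
  sublocale_set :> set L;
  sublocaleP : `[< is_sublocale sublocale_set >] }.

HB.instance Definition _ d (L : frameType d) :=
  [isSub for @sublocale_set d L].
HB.instance Definition _ d (L : frameType d) :=
  [Choice of sublocale L by <:].
(* The order on [set L] is inclusion, so this is the inclusion order. *)
HB.instance Definition _ d (L : frameType d) :=
  [SubChoice_isSubPOrder of sublocale L by <: with set_display].

Section SublocaleCoframe.
Context d (L : frameType d).
Implicit Types (S T : sublocale L) (a : L).

Lemma le_sublocale S T : S <= T <-> (S : set L) `<=` T.
Proof. by rewrite -Order.le_val; split=> /subsetPset. Qed.

Lemma sublocale_bigcap (A : set (sublocale L)) :
  is_sublocale (\bigcap_(S in A) (S : set L)).
Proof.
split=> [B BA S AS|x s sA S AS]; case: (asboolP _ (sublocaleP S)) => cm ci.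
  by apply: cm => x /BA; apply.
by apply: ci; apply: sA.
Qed.

Definition sublocale_inf (A : set (sublocale L)) : sublocale L :=
  Sublocale (asboolT (sublocale_bigcap A)).

Lemma sublocale_infP (A : set (sublocale L)) : infimums A (sublocale_inf A).
Proof.
split=> [S AS|T lbT]; apply/le_sublocale; first by move=> x; apply.
by move=> x Tx S AS; have /le_sublocale := lbT _ AS; apply.
Qed.

Lemma ex_sublocale_inf (A : set (sublocale L)) : infimums A !=set0.
Proof. by exists (sublocale_inf A); apply: sublocale_infP. Qed.

HB.instance Definition _ :=
  POrder_isComplete.Build set_display (sublocale L) ex_sublocale_inf.

Lemma sublocale_bigmeet (A : set (sublocale L)) :
  bigmeet A = \bigcap_(S in A) (S : set L) :> set L.
Proof.
suff -> : bigmeet A = sublocale_inf A by [].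
have [lb glb] := sublocale_infP A.
apply/le_anti/andP; split; first by apply: glb => S; apply: bigmeet_lb.
exact: bigmeet_glb.
Qed.

Lemma is_sublocale_join S T :
  is_sublocale [set x | exists s t,
    [/\ sublocale_set S s, sublocale_set T t & x = s `&` t]].
Proof.
case: (asboolP _ (sublocaleP S)) => Sm Si.
case: (asboolP _ (sublocaleP T)) => Tm Ti.
split=> [A sA|x _ [s [t [Ss Tt ->]]]]; last first.
  exists (imp x s), (imp x t); split; [exact: Si|exact: Ti|exact: imp_meetr].
pose B := [set s | sublocale_set S s /\
  exists t, sublocale_set T t /\ A (s `&` t)].
pose C := [set t | sublocale_set T t /\
  exists s, sublocale_set S s /\ A (s `&` t)].
exists (bigmeet B), (bigmeet C); split; first by apply: Sm => s [].
  by apply: Tm => t [].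
apply/le_anti/andP; split; last first.
  apply: bigmeet_glb => x Ax; have [s [t [Ss Tt xE]]] := sA _ Ax.
  rewrite xE in Ax *; apply: leI2; apply: bigmeet_lb.
    by split=> //; exists t.
  by split=> //; exists s.
rewrite lexI; apply/andP; split; apply: bigmeet_glb.
  by move=> s [Ss [t [Tt Ast]]]; apply: le_trans (bigmeet_lb Ast) (leIl _ _).
by move=> t [Tt [s [Ss Ast]]]; apply: le_trans (bigmeet_lb Ast) (leIr _ _).
Qed.

Lemma sublocale_top S : sublocale_set S \top.
Proof.
case: (asboolP _ (sublocaleP S)) => Sm _.
suff <- : bigmeet set0 = \top :> L by apply: Sm.
by apply/le_anti; rewrite lex1; apply: bigmeet_glb.
Qed.

Lemma sublocale_joinP S T x :
  sublocale_set (S `|` T) x <-> 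
  exists s t, [/\ sublocale_set S s, sublocale_set T t & x = s `&` t].
Proof.
split=> [|[s [t [Ss Tt ->]]]]; last first.
  have [STm _] := asboolP _ (sublocaleP (S `|` T)).
  have -> : s `&` t = bigmeet [set s; t].
    apply/le_anti; rewrite lexI !bigmeet_lb ?andbT; [|by right|by left].
    by apply: bigmeet_glb => _ [] ->; rewrite ?leIl ?leIr.
  have /le_sublocale leS : S <= S `|` T by rewrite leUl.
  have /le_sublocale leT : T <= S `|` T by rewrite leUr.
  by apply: STm => _ [] ->; [apply: leS|apply: leT].
pose ST : sublocale L := Sublocale (asboolT (is_sublocale_join S T)).
suff /le_sublocale : S `|` T <= ST by apply.
rewrite leUx; apply/andP; split; apply/le_sublocale => y Sy /=.
  by exists y, \top; split; rewrite ?meetx1 //; apply: sublocale_top.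
by exists \top, y; split; rewrite ?meet1x //; apply: sublocale_top.
Qed.

Lemma sublocale_join_bigmeet S (A : set (sublocale L)) :
  S `|` bigmeet A = bigmeet [set S `|` T | T in A].
Proof.
apply/le_anti/andP; split.
  apply: bigmeet_glb => _ [T AT <-]; exact: leU2 (lexx S) (bigmeet_lb AT).
apply/le_sublocale => b; rewrite sublocale_bigmeet => bA.
case: (asboolP _ (sublocaleP S)) => Sm Si.
pose s := bigmeet [set t | sublocale_set S t /\ b <= t].
have Ss : sublocale_set S s by apply: Sm => t [].
have bs : b <= s by apply: bigmeet_glb => t [].
apply/sublocale_joinP; exists s, (imp s b); split=> //.
  rewrite sublocale_bigmeet => T AT.
  have /sublocale_joinP [u [t [Su Tt bE]]] := bA _ (ex_intro2 _ _ T AT erefl).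
  have su : s <= u by apply: bigmeet_lb; split=> //; rewrite bE leIl.
  have -> : imp s b = imp s t.
    rewrite bE imp_meetr; apply/le_anti; rewrite leIr lexI lexx andbT.
    by rewrite !le_imp (le_trans (leIr _ _) su).
  by case: (asboolP _ (sublocaleP T)) => _; apply.
apply/le_anti; rewrite lexI bs le_imp leIl /=.
by rewrite meetC -le_imp.
Qed.

HB.instance Definition _ :=
  CompleteLattice_isCoframe.Build set_display (sublocale L)
    sublocale_join_bigmeet.

Lemma is_sublocale_open a : is_sublocale (range (imp a)).
Proof.
split=> [A sA|x _ [b _ <-]]; last first.
  by exists (imp x b) => //; rewrite !imp_uncurry meetC.
exists (bigmeet A) => //; rewrite imp_bigmeet; congr bigmeet.
apply/seteqP; split=> [_ [x Ax <-]|x Ax].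
  by have [b _ bx] := sA _ Ax; rewrite -bx imp_uncurry meetxx bx.
by exists x => //; have [b _ <-] := sA _ Ax; rewrite imp_uncurry meetxx.
Qed.

Lemma is_sublocale_closed a : is_sublocale [set x | a <= x].
Proof.
split=> [A sA|x s /= le_as]; first exact: bigmeet_glb.
by rewrite /= le_imp (le_trans (leIl _ _) le_as).
Qed.

Definition open_sublocale a : sublocale L :=
  Sublocale (asboolT (is_sublocale_open a)).

Definition closed_sublocale a : sublocale L :=
  Sublocale (asboolT (is_sublocale_closed a)).

(* The meets and joins are those of S(L): meets are intersections, see
   [sublocale_bigmeet]. *)
Definition S_open : set (sublocale L) :=
  [set bigmeet (open_sublocale @` A) | A in setT].

Definition S_closed : set (sublocale L) :=
  [set bigjoin (closed_sublocale @` A) | A in setT].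

Definition scattered := boolean_lattice (sublocale L).

End SublocaleCoframe.
Arguments open_sublocale {d} L a.
Arguments closed_sublocale {d} L a.
Arguments S_open {d} L.
Arguments S_closed {d} L.
Arguments scattered {d} L.

(* A Raney extension (L, C) is given by the coframe C and the inclusion of L
   in C, here an order embedding i : L -> C. *)
Section Raney.
Context d (L : frameType d).

Definition raney_extension d' (C : coframeType d') (i : L -> C) :=
  [/\ {mono i : x y / x <= y},
      (forall c : C, exists A : set L, c = bigmeet (i @` A)),
      (forall A : set L, i (bigjoin A) = bigjoin (i @` A)),
      i \top = \top /\ {morph i : x y / x `&` y} &
      forall A : set L, strongly_exact_meet A ->
        i (bigmeet A) = bigmeet (i @` A)].

End Raney.

Definition raney_morphism d1 d2 d3 d4 (L : frameType d1) (C : coframeType d2)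
    (M : frameType d3) (D : coframeType d4) (i : L -> C) (j : M -> D)
    (f : C -> D) :=
  coframe_map f /\
  exists g : L -> M, frame_map g /\ forall x, f (i x) = j (g x).

Definition raney_isomorphic d1 d2 d3 d4 (L : frameType d1)
    (C : coframeType d2) (M : frameType d3) (D : coframeType d4)
    (i : L -> C) (j : M -> D) :=
  exists (f : C -> D) (f' : D -> C),
    [/\ raney_morphism i j f, raney_morphism j i f', cancel f f' &
        cancel f' f].

(* Isomorphisms may restrict to a nontrivial automorphism of L. *)
Definition sole_raney_extension d (L : frameType d) d' (C : coframeType d')
    (i : L -> C) :=
  raney_extension i /\
  forall (d'' : Order.disp_t) (D : coframeType d'') (j : L -> D),
    raney_extension j -> raney_isomorphic i j.

Definition has_unique_raney_extension d (L : frameType d) :=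
  exists (d' : Order.disp_t) (C : coframeType d') (i : L -> C),
    sole_raney_extension i.

(* Main.v *)
Require Import Defs.
From HB Require Import structures.
From mathcomp Require Import all_boot all_order.
From mathcomp Require Import boolp classical_sets.

Set Implicit Arguments.
Unset Strict Implicit.
Unset Printing Implicit Defensive.

Import Order.TTheory.
Local Open Scope classical_set_scope.
Local Open Scope order_scope.

(** The proof rests on a dictionary between filters, sublocales and Raney
    extensions.

    Filters and sublocales.  The elements y whose open sublocale contains a
    given sublocale form a strongly exact filter ([fixing_SE]), and
    conversely a strongly exact filter is recovered from the intersection of
    the open sublocales of its members ([Filt_SE_enforces]).  A filter is
    regular iff it is {x | x v a = 1 for all a in A} for some set A
    ([Filt_RP]), which says exactly that o(x) contains the join of the c(a).
    Regular filters are exact, exact filters are strongly exact, and in a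
    subfit frame exact filters are regular ([subfit_Filt_E_sub_R]).  So both
    filter conditions say that every strongly exact filter is regular.

    Regularity and scatteredness.  If every strongly exact filter is regular,
    then every closed sublocale is an intersection of open ones
    ([closed_fitted]), hence so is every sublocale ([all_fitted]), and the
    filter pseudocomplementary to the one attached to S yields a complement
    of S ([scattered_of_regular]).  Conversely, in a scattered subfit frame
    every sublocale is a join of closed ones ([scattered_closed_generated]),
    in particular every intersection of open ones is; reading this back
    through the dictionary gives regularity ([regular_of_open_closed]).

    Raney extensions.  An element c of an extension (L, C) is determined by
    the filter of those x in L above c.  These filters are strongly exact
    ([trace_SE]) and every exact filter is among them ([trace_bigmeet]); so
    when the two classes agree any two extensions are isomorphic
    ([raney_iso_of_Filt_E]).  Both bounds are attained: strongly exact filters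
    and exact filters, ordered by reverse inclusion, are Raney extensions
    ([principal_raney]).  An isomorphism of extensions may move L by an
    automorphism, but automorphisms preserve exactness, so uniqueness of the
    extension forces the two classes to coincide ([unique_raney_Filt_E]). *)

(** * Exact meets and classes of filters *)

Lemma bigmeet_mono d (T : completeLatticeType d) (A B : set T) :
  (forall b, B b -> exists2 a, A a & a <= b) -> bigmeet A <= bigmeet B.
Proof.
move=> h; apply: bigmeet_glb => b /h [a Aa]; apply: le_trans.
exact: bigmeet_lb.
Qed.

Section FrameTheory.
Context d (L : frameType d).
Implicit Types (x y z t a b : L) (A B F G H : set L).

Lemma le_imp_self x y : y <= imp x y.
Proof. by rewrite le_imp leIl. Qed.

Lemma imp_fixP x y : imp x y <= y -> imp x y = y.
Proof. by move=> h; apply/le_anti; rewrite h le_imp_self. Qed.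

Lemma imp_eq1 x y : (imp x y == \top) = (x <= y).
Proof. by rewrite -le1x le_imp meet1x. Qed.

Lemma imp1x y : imp \top y = y.
Proof. by apply: imp_fixP; rewrite -[imp _ _]meetx1 -le_imp. Qed.

Lemma imp_antimono x y z : x <= y -> imp y z <= imp x z.
Proof.
move=> xy; rewrite le_imp.
by apply: le_trans (leI2 (lexx _) xy) _; rewrite -le_imp.
Qed.

Lemma meet_join_le t a x y :
  (t `&` (a `|` x) <= y) = (t `&` a <= y) && (t `&` x <= y).
Proof. by rewrite meetC -le_imp leUx !le_imp !(meetC t). Qed.

Lemma join_cover_le t a b y :
  a `|` b = \top -> t `&` a <= y -> t `&` b <= y -> t <= y.
Proof. by move=> ab ta tb; rewrite -(meetx1 t) -ab meet_join_le ta tb. Qed.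

Lemma imp_join a x y : imp (a `|` x) y = imp a y `&` imp x y.
Proof.
apply/le_anti; rewrite lexI !imp_antimono ?leUl ?leUr //= le_imp.
rewrite meet_join_le -[X in X && _]le_imp -[X in _ && X]le_imp.
by rewrite leIl leIr.
Qed.

(** In terms of sublocales: the intersection of the o(a), for a in A, is
    contained in o(x).  Thus [strongly_exact_meet A] unfolds to
    [enforces A (bigmeet A)]. *)
Definition enforces A x :=
  forall y, (forall a, A a -> imp a y = y) -> imp x y = y.

(** Every y is the meet of x -> y, which lies in o(x), and (x -> y) -> y; when
    y is in o(a v x), the join of o(a) and o(x), the latter lies in o(a). *)
Lemma imp_join_fix a x y :
  imp (a `|` x) y = y -> imp a (imp (imp x y) y) = imp (imp x y) y.
Proof.
move=> ay; apply: imp_fixP; rewrite le_imp -[X in _ <= X]ay le_imp meet_join_le.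
apply/andP; split; last by rewrite -meetA (le_trans (leIr _ _)) // -le_imp.
by rewrite meetAC -le_imp -le_imp.
Qed.

(** Sublocales form a coframe, so that joining with o(x) commutes with the
    intersection of the o(a). *)
Lemma enforces_join A c x :
  enforces A c -> enforces [set a `|` x | a in A] (c `|` x).
Proof.
move=> Ac y yA; apply: imp_fixP; rewrite imp_join -le_imp.
have <- : imp c (imp (imp x y) y) = imp (imp x y) y.
  by apply: Ac => a Aa; apply/imp_join_fix/yA; exists a.
by rewrite le_imp (le_trans _ (le_imp_self _ _)) // -le_imp.
Qed.

(** Apply the hypothesis to m -> x, with m the meet of A: every a in A is
    above m, hence fixes m -> x, so x fixes it too, which makes it \top. *)
Lemma enforces_bigmeet A x :
  (forall a, A a -> x <= a) -> enforces A x -> bigmeet A = x.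
Proof.
move=> xA Ax; apply/le_anti; rewrite bigmeet_glb // andbT -imp_eq1.
rewrite -(Ax (imp (bigmeet A) x)) ?imp_eq1 ?le_imp_self // => a Aa.
apply: imp_fixP; rewrite imp_uncurry.
by rewrite (meet_r (bigmeet_lb Aa)).
Qed.

Lemma strongly_exact_exact A : strongly_exact_meet A -> exact_meet A.
Proof.
move=> Ase a; apply/esym/enforces_bigmeet; last exact: enforces_join.
by move=> _ [b Ab <-]; apply: leU2 (bigmeet_lb Ab) (lexx a).
Qed.

Lemma strongly_exact_join A x : strongly_exact_meet A ->
  strongly_exact_meet [set a `|` x | a in A].
Proof.
move=> Ase; rewrite /strongly_exact_meet -(strongly_exact_exact Ase).
exact: enforces_join.
Qed.

Lemma exact_join A x : exact_meet A -> exact_meet [set a `|` x | a in A].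
Proof.
move=> Ae b; rewrite -Ae -joinA Ae image_comp; congr bigmeet.
by apply: eq_imagel => a _ /=; rewrite joinA.
Qed.

(** The meet of the f v x, for f in F, is strongly exact and equal to x, so
    that F must contain it. *)
Lemma Filt_SE_enforces F x : Filt_SE L F -> enforces F x -> F x.
Proof.
move=> [[_ up _] Fse] Fx.
have Ex : enforces [set f `|` x | f in F] x.
  by rewrite -[X in enforces _ X]joinxx; apply: enforces_join.
have mE : bigmeet [set f `|` x | f in F] = x.
  by apply: enforces_bigmeet => // _ [f _ <-]; apply: leUr.
rewrite -mE; apply: Fse; last by rewrite /strongly_exact_meet mE.
by move=> _ [f Ff <-]; apply: up Ff (leUl _ _).
Qed.

Lemma Filt_E_sub_SE : Filt_E L `<=` Filt_SE L.
Proof.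
by move=> F [Ff Fe]; split=> // A AF /strongly_exact_exact; apply: Fe.
Qed.

(** With closed sublocales: the x such that o(x) contains the join of the
    c(a), for a in A. *)
Definition codense A := [set x | forall a, A a -> x `|` a = \top].

Lemma lattice_filter_codense A : lattice_filter (codense A).
Proof.
split=> [a _|x y xA xy a Aa|x y xA yA a Aa]; first by rewrite join1x.
  by apply/eqP; rewrite -le1x -(xA a Aa) leU2.
apply/eqP; rewrite -le1x.
apply: (join_cover_le (yA a Aa)); rewrite meet1x ?leUr //.
by apply: (join_cover_le (xA a Aa)); rewrite ?(meetC y) ?leUl // leIxl ?leUr.
Qed.

Lemma lattice_filter_principal x : lattice_filter [set y | x <= y].
Proof.
split=> [|y z /=|y z /= xy xz]; rewrite /= ?lex1 ?lexI ?xy //.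
exact: le_trans.
Qed.

(** The pseudocomplement of a filter F consists of the x such that the
    principal filter of x meets F trivially, that is [codense F].  For an
    arbitrary A, the filter [codense A] is the pseudocomplement of
    [codense (codense A)]. *)
Lemma Filt_RP H : Filt_R L H <-> exists A, H = codense A.
Proof.
split=> [[Hf [F [Ff HF]]]|[A ->]].
  exists F; apply/seteqP; split=> [x Hx a Fa|x xF].
    apply: (((HF H Hf).1 (fun=> id)) (x `|` a)); split.
      by case: Hf => _ up _; apply: up Hx (leUl _ _).
    by case: Ff => _ up _; apply: up Fa (leUr _ _).
  have /HF := lattice_filter_principal x.
  case=> _; apply => //= y [/= xy Fy].
  by rewrite -(xF y Fy) /= (join_r xy).
split; first exact: lattice_filter_codense.
exists (codense (codense A)); split=> [|G [_ up _]].
  exact: lattice_filter_codense.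
split=> [GA g [/GA gA gAA]|GA g Gg a Aa]; first by rewrite -(gAA g gA) joinxx.
apply: (GA (g `|` a)); split; first exact: up Gg (leUl _ _).
by move=> h hA; rewrite joinC joinCA hA ?joinx1.
Qed.

Lemma Filt_R_sub_E : Filt_R L `<=` Filt_E L.
Proof.
move=> _ /Filt_RP [A ->]; split; first exact: lattice_filter_codense.
move=> B BA Be a Aa; rewrite Be; apply/eqP; rewrite -le1x.
by apply: bigmeet_glb => _ [b /BA bA <-]; rewrite bA.
Qed.

(** Taking u = \bot, the hypothesis says that x is the meet of the f v x for
    f in F; the other values of u make this meet exact. *)
Lemma Filt_E_absorb F x : Filt_E L F ->
  (forall u, bigmeet [set f `|` (x `|` u) | f in F] <= x `|` u) -> F x.
Proof.
move=> [[_ up _] Fe] le_xu.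
have mE : bigmeet [set f `|` x | f in F] = x.
  apply/le_anti; rewrite -{2}(joinx0 x) (le_trans _ (le_xu \bot)) ?joinx0 //=.
  by apply: bigmeet_glb => _ [f _ <-]; rewrite leUr.
rewrite -mE; apply: Fe => [_ [f Ff <-]|u]; first exact: up Ff (leUl _ _).
rewrite mE image_comp; apply/le_anti; apply/andP; split.
  by apply: bigmeet_glb => _ [f _ <-]; rewrite /= leU2 ?leUr.
rewrite (le_trans _ (le_xu u)) //; apply: bigmeet_mono => _ [f Ff <-].
by exists (f `|` x `|` u); [exists f|rewrite joinA].
Qed.

(** An exact filter F equals its double pseudocomplement.  If x lies in the
    latter but the meet of the f v x v u is not below x v u, subfitness gives
    w with x v u v w <> 1 while f v x v u v w = 1 for all f in F.  Then
    x v u v w is in [codense F], so that joining it with x gives 1, which is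
    absurd. *)
Lemma subfit_Filt_E_sub_R : subfit L -> Filt_E L `<=` Filt_R L.
Proof.
move=> sL F FE; apply/Filt_RP; exists (codense F).
apply/seteqP; split=> [x Fx a aF|x xF]; first by rewrite joinC aF.
apply: (Filt_E_absorb FE) => u; apply: contrapT => /negP /sL [w [w1]]; apply.
rewrite -(joinxx x) -2!joinA; apply: xF => f Ff; apply/eqP.
rewrite joinC !joinA -le1x -w1 leUx leUr andbT (le_trans _ (leUl _ _)) //.
by apply: bigmeet_lb; exists f; rewrite ?joinA.
Qed.

End FrameTheory.

(** * Open and closed sublocales *)

Section Sublocales.
Context d (L : frameType d).
Implicit Types (x y z a b s t u : L) (A B : set L) (S T : sublocale L).

Lemma sublocale_imp S x s : sublocale_set S s -> sublocale_set S (imp x s).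
Proof. by case: (asboolP _ (sublocaleP S)) => _; apply. Qed.

Lemma sublocale_meet S A : A `<=` S -> sublocale_set S (bigmeet A).
Proof. by case: (asboolP _ (sublocaleP S)) => Sm _; apply: Sm. Qed.

Lemma mem_meet S T s :
  sublocale_set (S `&` T) s -> sublocale_set S s /\ sublocale_set T s.
Proof.
have /le_sublocale STS := leIl S T; have /le_sublocale STT := leIr T S.
by move=> STs; split; [apply: STS|apply: STT].
Qed.

Lemma mem_open a y : sublocale_set (open_sublocale L a) y <-> imp a y = y.
Proof.
split=> [[b _ <-]|ay]; first by rewrite imp_uncurry meetxx.
by exists y.
Qed.

Lemma le_open S a :
  S <= open_sublocale L a <-> forall s, sublocale_set S s -> imp a s = s.
Proof.
split=> [/le_sublocale Sa s /Sa /mem_open //|h].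
by apply/le_sublocale => s /h /mem_open.
Qed.

Lemma mem_bigmeet_open A y :
  sublocale_set (bigmeet (open_sublocale L @` A)) y <->
  forall a, A a -> imp a y = y.
Proof.
rewrite sublocale_bigmeet; split=> [yA a Aa|yA _ [a Aa <-]]; last first.
  exact/mem_open/yA.
by apply/mem_open/yA; exists a.
Qed.

Lemma closed_le_open a x :
  closed_sublocale L a <= open_sublocale L x <-> a `|` x = \top.
Proof.
split=> [/le_open /(_ (a `|` x)) /= h|ax].
  by rewrite -h ?leUl //; apply/eqP; rewrite imp_eq1 leUr.
apply/le_open => s /= le_as; apply: imp_fixP.
apply: (join_cover_le ax); last by rewrite -le_imp.
exact: le_trans (leIr _ _) le_as.
Qed.

Lemma open_mono x y : (open_sublocale L x <= open_sublocale L y) = (x <= y).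
Proof.
apply/idP/idP => [/le_open h|xy].
  by rewrite -imp_eq1 -(h (imp x y)) ?imp_eq1 ?le_imp_self //; exists y.
apply/le_open => s /mem_open xs; apply: imp_fixP.
by rewrite -[X in _ <= X]xs imp_antimono.
Qed.

Lemma open_bigjoin A :
  open_sublocale L (bigjoin A) = bigjoin (open_sublocale L @` A).
Proof.
apply/le_anti/andP; split; last first.
  by apply: bigjoin_lub => _ [a Aa <-]; rewrite open_mono bigjoin_ub.
apply/le_sublocale => s /mem_open <-.
have -> : imp (bigjoin A) s = bigmeet [set imp a s | a in A].
  apply/le_anti/andP; split.
    by apply: bigmeet_glb => _ [a Aa <-]; rewrite imp_antimono ?bigjoin_ub.
  rewrite le_imp meet_bigjoin; apply: bigjoin_lub => _ [a Aa <-].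
  by rewrite -le_imp bigmeet_lb //; exists a.
apply: sublocale_meet => _ [a Aa <-].
have /le_sublocale : open_sublocale L a <= bigjoin (open_sublocale L @` A).
  by apply: bigjoin_ub; exists a.
by apply; exists s.
Qed.

Lemma open_meet x y :
  open_sublocale L (x `&` y) = open_sublocale L x `&` open_sublocale L y.
Proof.
apply/le_anti; rewrite lexI !open_mono leIl leIr /=.
apply/le_open => s sxy.
have [/mem_open xs /mem_open ys] := mem_meet sxy.
by rewrite -imp_uncurry ys xs.
Qed.

Lemma open_cover x y : x `|` y = \top ->
  open_sublocale L x `|` open_sublocale L y = \top.
Proof.
move=> xy; apply/le_anti; rewrite lex1 /=; apply/le_sublocale => s _.
apply/sublocale_joinP; exists (imp x s), (imp y s); split; [by exists s..|].
by rewrite -imp_join xy imp1x.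
Qed.

Lemma open_top : open_sublocale L \top = \top.
Proof. by rewrite -(open_cover (joinx1 \top)) joinxx. Qed.

Lemma sublocale_eq0 S : (forall s, sublocale_set S s -> s = \top) -> S = \bot.
Proof.
move=> S1; apply/le_anti; rewrite le0x andbT.
by apply/le_sublocale => s /S1 ->; apply: sublocale_top.
Qed.

Lemma closed_le_open_eq1 a :
  closed_sublocale L a <= open_sublocale L a -> a = \top.
Proof. by move=> /closed_le_open; rewrite joinxx. Qed.

Lemma sublocale_joinI S T U : S `|` (T `&` U) = (S `|` T) `&` (S `|` U).
Proof.
have bigmeet2 (V W : sublocale L) : bigmeet [set V; W] = V `&` W.
  apply/le_anti; rewrite lexI !bigmeet_lb /=; try by [left|right].
  by apply: bigmeet_glb => _ [] ->; rewrite ?leIl ?leIr.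
by rewrite -!bigmeet2 join_bigmeet image_setU !image_set1.
Qed.

Lemma sublocale_meetUl :
  left_distributive (@Order.meet _ (sublocale L)) Order.join.
Proof.
move=> S T U; rewrite sublocale_joinI [(S `&` U) `|` U]join_r ?leIr //.
rewrite [(S `&` U) `|` T]joinC sublocale_joinI -meetA.
by rewrite [(T `|` U) `&` U]meet_r ?leUr // [T `|` S]joinC.
Qed.

(** For a sublocale P, the y such that o(y) contains P.  Allowing any set P
    lets an intersection of sublocales be given by its defining
    conditions. *)
Definition fixing (P : set L) := [set y | forall s, P s -> imp y s = s].

Lemma fixing_SE P : Filt_SE L (fixing P).
Proof.
split=> [|A AP Ase s Ps]; last by apply: Ase => a /AP; apply.
split=> [s _|x y xP xy s Ps|x y xP yP s Ps].
- exact: imp1x.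
- by apply: imp_fixP; rewrite -[X in _ <= X](xP s Ps) imp_antimono.
- by rewrite -imp_uncurry yP // xP.
Qed.

(** The hypothesis on z says that z lies in the intersection C of the open
    sublocales that contain c(x).  The regular filter [codense B] attached to
    the intersection of C and o(x) contains x, so each b in B has x v b = 1,
    and so o(b) contains C; then b itself is in the filter, which forces
    b = 1.  Hence the filter is improper and C does not meet o(x), which is
    what x <= z amounts to, as x -> z lies in both. *)
Lemma closed_fitted : Filt_SE L `<=` Filt_R L ->
  forall x z, (forall y, x `|` y = \top -> imp y z = z) -> x <= z.
Proof.
move=> SER x z zx.
(* P is the intersection of C and o(x). *)
pose P := [set s | (forall y, x `|` y = \top -> imp y s = s) /\ imp x s = s].
have /Filt_RP [B PB] := SER _ (fixing_SE P).
have Px : fixing P x by move=> s [].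
have P0 : fixing P \bot.
  rewrite PB => b Bb; rewrite join0x -[b]joinxx.
  suff : fixing P b by rewrite PB; apply.
  by move=> s [h _]; apply: h; move: Px; rewrite PB; apply.
rewrite -imp_eq1 -(P0 (imp x z)) ?imp_eq1 ?le0x //.
split=> [y xy|]; last by rewrite imp_uncurry meetxx.
by rewrite imp_uncurry meetC -imp_uncurry zx.
Qed.

(** Given t in every open sublocale that contains S, let x be the least
    element of S above t.  Whenever x v y = 1, the sublocale o(t v y)
    contains S, hence t, so that y -> t = t; as c(x) is fitted, x <= t. *)
Lemma all_fitted :
  (forall x z, (forall y, x `|` y = \top -> imp y z = z) -> x <= z) ->
  forall S, S = bigmeet (open_sublocale L @` fixing S).
Proof.
move=> cF S; apply/le_anti/andP; split.
  by apply/le_sublocale => s Ss; apply/mem_bigmeet_open => a; apply.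
apply/le_sublocale => t /mem_bigmeet_open tS.
set x := bigmeet [set s | sublocale_set S s /\ t <= s].
have Sx : sublocale_set S x by apply: sublocale_meet => s [].
suff xt : x <= t.
  suff -> : t = x by [].
  by apply/le_anti; rewrite xt andbT; apply: bigmeet_glb => s [].
apply: cF => y xy; rewrite -[RHS](tS (t `|` y)).
  rewrite imp_join (_ : imp t t = \top) ?meet1x //.
  by apply/eqP; rewrite imp_eq1.
move=> s Ss; apply: imp_fixP; rewrite imp_join.
set u := _ `&` _.
have xu : x <= imp u s.
  apply: bigmeet_lb; split; first exact: sublocale_imp.
  by rewrite le_imp meetC -le_imp leIl.
apply: (join_cover_le xy); first by rewrite meetC -le_imp.
by rewrite -le_imp leIr.
Qed.

(** S is the intersection of the o(g) for g in [fixing S]; the candidate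
    complement is the intersection of the o(h) for h in the
    pseudocomplement H of that filter.  Joining with S gives the top by
    coframe distributivity, since g v h = 1.  The regular filter [codense B]
    attached to the meet contains [fixing S] and H, so each b in B is in H,
    hence in the filter, which forces b = 1: the meet is trivial. *)
Lemma scattered_of_regular : Filt_SE L `<=` Filt_R L -> scattered L.
Proof.
move=> SER; split=> [|S]; first exact: sublocale_meetUl.
have fitted := all_fitted (closed_fitted SER).
pose H := codense (fixing S).
exists (bigmeet (open_sublocale L @` H)); split; last first.
  rewrite join_bigmeet; apply/le_anti; rewrite lex1.
  apply: bigmeet_glb => _ [_ [h Hh <-] <-].
  rewrite (fitted S) joinC join_bigmeet.
  apply: bigmeet_glb => _ [_ [g Gg <-] <-].
  by rewrite open_cover ?Hh.
set T := _ `&` _.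
have /Filt_RP [B TB] := SER _ (fixing_SE T).
have STg g : fixing S g -> fixing T g.
  by move=> Sg s /mem_meet [/Sg].
have HTg h : H h -> fixing T h.
  by move=> Hh s /mem_meet [_ /mem_bigmeet_open]; apply.
have T0 : fixing T \bot.
  rewrite TB => b Bb; rewrite join0x -[b]joinxx.
  suff : fixing T b by rewrite TB; apply.
  by apply: HTg => g /STg; rewrite TB joinC; apply.
apply: sublocale_eq0 => s Ts; rewrite -(T0 s Ts).
by apply/eqP; rewrite imp_eq1 le0x.
Qed.

(** A strongly exact filter consists of the x such that o(x) contains the
    intersection S of its open sublocales.  If S is the join of the c(a) for
    a in A, this is the condition x v a = 1 for all a in A. *)
Lemma regular_of_open_closed :
  S_open L `<=` S_closed L -> Filt_SE L `<=` Filt_R L.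
Proof.
move=> oc F FSE; apply/Filt_RP.
have [|A _ AE] := oc (bigmeet (open_sublocale L @` F)); first by exists F.
exists A; apply/seteqP; split=> [x Fx a Aa|x xA].
  rewrite joinC; apply/closed_le_open.
  have aF : closed_sublocale L a <= bigmeet (open_sublocale L @` F).
    by rewrite -AE; apply: bigjoin_ub; exists a.
  by apply: le_trans aF _; apply: bigmeet_lb; exists x.
suff /le_open xF : bigmeet (open_sublocale L @` F) <= open_sublocale L x.
  by apply: (Filt_SE_enforces FSE) => y /mem_bigmeet_open; apply: xF.
rewrite -AE; apply: bigjoin_lub => _ [a Aa <-].
by apply/closed_le_open; rewrite joinC xA.
Qed.

(** Let b be outside S and x be the least element of S above b.  As x is not
    below b, subfitness gives u with x v u = 1 and b v u <> 1.  An element of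
    S above b v u is above x as well, hence is 1. *)
Lemma subfit_disjoint_closed S : subfit L -> S <> \top ->
  exists w, w <> \top /\ closed_sublocale L w `&` S = \bot.
Proof.
move=> sL SN1; have [b Sb] : exists b, ~ sublocale_set S b.
  apply: contrapT => nS; apply: SN1; apply/le_anti; rewrite lex1.
  by apply/le_sublocale => s _; apply: contrapT => Ss; apply: nS; exists s.
set x := bigmeet [set s | sublocale_set S s /\ b <= s].
have xb : ~~ (x <= b).
  apply/negP => xb; apply: Sb; suff -> : b = x.
    by apply: sublocale_meet => s [].
  by apply/le_anti; rewrite xb andbT; apply: bigmeet_glb => s [].
have [u [xu bu]] := sL _ _ xb; exists (b `|` u); split=> //.
apply: sublocale_eq0 => s /mem_meet [/= ws Ss].
apply/eqP; rewrite -le1x -xu leUx (le_trans (leUr _ _) ws) andbT.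
by apply: bigmeet_lb; split=> //; apply: le_trans (leUl _ _) ws.
Qed.

(** Let S' be the join of the closed sublocales inside S, and T the
    complement of S.  If the join of S' and T were not everything, it would
    miss some nontrivial c(w); missing T, this c(w) would be inside S, hence
    inside S', which it misses too. *)
Lemma scattered_closed_generated : subfit L -> scattered L ->
  forall S, S = bigjoin
    (closed_sublocale L @` [set a | closed_sublocale L a <= S]).
Proof.
move=> sL [dl cpl] S; set S' := bigjoin _.
have S'S : S' <= S by apply: bigjoin_lub => _ [a aS <-].
apply/le_anti; rewrite S'S andbT; have [T [ST ST1]] := cpl S.
have [TS'|] := pselect (S' `|` T = \top).
  rewrite -[X in X <= _]meet1x -TS' dl [T `&` S]meetC ST joinx0; exact: leIl.
move=> /(subfit_disjoint_closed sL) [w [w1 w0]]; case: w1.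
apply: closed_le_open_eq1; rewrite (_ : closed_sublocale L w = \bot) ?le0x //.
have wS : closed_sublocale L w <= S.
  rewrite -[X in X <= _]meet1x -ST1 dl leUx leIl /=.
  rewrite meetC; apply: le_trans (le0x S); rewrite -w0.
  by apply: leI2 => //; apply: leUr.
have wS' : closed_sublocale L w <= S' by apply: bigjoin_ub; exists w.
by rewrite -w0; apply/esym/meet_l; rewrite lexUl.
Qed.

Lemma open_raney :
  (forall S, S = bigmeet (open_sublocale L @` fixing S)) ->
  raney_extension (open_sublocale L).
Proof.
move=> fitted; split.
- exact: open_mono.
- by move=> S; exists (fixing S).
- exact: open_bigjoin.
- by split; [exact: open_top|exact: open_meet].
move=> A Ase; apply/le_anti/andP; split.
  by apply: bigmeet_glb => _ [a Aa <-]; rewrite open_mono bigmeet_lb.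
by apply/le_open => s /mem_bigmeet_open; apply: Ase.
Qed.

End Sublocales.

(** * Raney extensions and their filters *)

Section ExtensionFilters.
Context d (L : frameType d) d' (C : coframeType d') (i : L -> C).
Hypothesis iR : raney_extension i.
Implicit Types (x y : L) (c : C) (A F : set L).

Definition trace c := [set x | c <= i x].

Lemma trace_SE c : Filt_SE L (trace c).
Proof.
case: iR => imono _ _ [i1 iI] ise.
split=> [|A AF /ise Ai]; last first.
  by rewrite /trace /= Ai; apply: bigmeet_glb => _ [a /AF ? <-].
split=> [|x y /= cx xy|x y /= cx cy]; rewrite /trace /=.
- by rewrite i1 lex1.
- by rewrite (le_trans cx) // imono.
- by rewrite iI lexI cx.
Qed.

Lemma bigmeet_trace c : bigmeet (i @` trace c) = c.
Proof.
case: iR => _ gen _ _ _; apply/le_anti/andP; split.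
  have [A cA] := gen c; rewrite [X in _ <= X]cA; apply: bigmeet_mono.
  move=> _ [a Aa <-]; exists (i a) => //; exists a => //.
  by rewrite /trace /= cA bigmeet_lb //; exists a.
by apply: bigmeet_glb => _ [x cx <-].
Qed.

Lemma trace_embed x : trace (i x) = [set y | x <= y].
Proof.
by case: iR => imono _ _ _ _; apply/seteqP; split=> y; rewrite /trace /= imono.
Qed.

Lemma raney_join : {morph i : x y / x `|` y}.
Proof.
have bigjoin2 dT (T : completeLatticeType dT) (s t : T) :
    bigjoin [set s; t] = s `|` t.
  apply/le_anti/andP; split.
    by apply: bigjoin_lub => _ [] ->; rewrite ?leUl ?leUr.
  by rewrite leUx !bigjoin_ub //; [right|left].
case: iR => _ _ iU _ _ x y.
by rewrite -!bigjoin2 iU image_setU !image_set1.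
Qed.

(** If x is above the meet of F in C, coframe distributivity computes in C the
    meets of the f v x v u, which shows that the meet of the f v x is exact
    in L. *)
Lemma trace_bigmeet F : Filt_E L F -> trace (bigmeet (i @` F)) = F.
Proof.
move=> FE; case: iR => imono _ _ _ _; apply/seteqP; split=> x; last first.
  by move=> Fx; apply: bigmeet_lb; exists x.
rewrite /trace /= => Fx; apply: (Filt_E_absorb FE) => u.
rewrite -imono; have -> : i (x `|` u) = i (x `|` u) `|` bigmeet (i @` F).
  by apply/esym/join_l/(le_trans Fx); rewrite imono leUl.
rewrite join_bigmeet; apply: bigmeet_glb => _ [_ [f Ff <-] <-].
by rewrite -raney_join imono [X in _ <= X]joinC bigmeet_lb //; exists f.
Qed.

Lemma le_trace c c' : (c <= c') <-> trace c' `<=` trace c.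
Proof.
split=> [cc' x|tt']; first exact: le_trans.
rewrite -(bigmeet_trace c) -(bigmeet_trace c'); apply: bigmeet_mono.
by move=> _ [x /tt' cx <-]; exists (i x) => //; exists x.
Qed.

End ExtensionFilters.

Lemma coframe_map_of_iso d d' (C : coframeType d) (D : coframeType d')
    (f : C -> D) (g : D -> C) :
  {homo f : x y / x <= y} -> {homo g : x y / x <= y} ->
  cancel f g -> cancel g f -> coframe_map f.
Proof.
move=> fm gm fK gK; split=> [A||x y]; apply/le_anti/andP; split.
- by apply: bigmeet_glb => _ [a Aa <-]; apply/fm/bigmeet_lb.
- rewrite -[X in X <= _]gK; apply/fm/bigmeet_glb => a Aa.
  by rewrite -[a]fK; apply/gm/bigmeet_lb; exists a.
- by rewrite -[X in _ <= X]gK; apply: fm; rewrite le0x.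
- exact: le0x.
- rewrite -[X in _ <= X]gK; apply: fm; rewrite leUx.
  by apply/andP; split; rewrite -[X in X <= _]fK gm ?leUl ?leUr.
- by rewrite leUx !fm ?leUl ?leUr.
Qed.

Lemma coframe_map_homo d d' (C : coframeType d) (D : coframeType d')
  (f : C -> D) : coframe_map f -> {homo f : x y / x <= y}.
Proof. by move=> [_ _ fU] x y xy; rewrite -(join_r xy) fU leUl. Qed.

Lemma frame_map_id d (L : frameType d) : frame_map (@id L).
Proof. by split=> // A; rewrite image_id. Qed.

Lemma frame_map_homo d d' (L : frameType d) (M : frameType d')
  (f : L -> M) : frame_map f -> {homo f : x y / x <= y}.
Proof. by move=> [_ _ fI] x y xy; rewrite -(meet_l xy) fI leIr. Qed.

Lemma raney_iso_of_Filt_E d (L : frameType d) d1 (C : coframeType d1)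
    d2 (D : coframeType d2) (i : L -> C) (j : L -> D) :
  raney_extension i -> raney_extension j -> Filt_SE L `<=` Filt_E L ->
  raney_isomorphic i j.
Proof.
move=> iR jR SEE.
pose f c := bigmeet (j @` trace i c); pose g c := bigmeet (i @` trace j c).
have tf c : trace j (f c) = trace i c.
  exact/(trace_bigmeet jR)/SEE/(trace_SE iR).
have tg c : trace i (g c) = trace j c.
  exact/(trace_bigmeet iR)/SEE/(trace_SE jR).
have fm : {homo f : x y / x <= y}.
  by move=> x y xy; apply/(le_trace jR); rewrite !tf; apply/(le_trace iR).
have gm : {homo g : x y / x <= y}.
  by move=> x y xy; apply/(le_trace iR); rewrite !tg; apply/(le_trace jR).
have fK : cancel f g by move=> c; rewrite /g tf (bigmeet_trace iR).
have gK : cancel g f by move=> c; rewrite /f tg (bigmeet_trace jR).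
exists f, g; split=> //; split; try exact: coframe_map_of_iso fm gm fK gK;
  try exact: coframe_map_of_iso gm fm gK fK.
- exists id; split=> [|x]; first exact: frame_map_id.
  by rewrite /f trace_embed // -(trace_embed jR) bigmeet_trace.
- exists id; split=> [|x]; first exact: frame_map_id.
  by rewrite /g trace_embed // -(trace_embed iR) bigmeet_trace.
Qed.

(** Exactness of a meet only involves the lattice operations of L, which an
    order automorphism preserves. *)
Lemma Filt_E_preimage d (L : frameType d) (g h : L -> L) F :
  {homo g : x y / x <= y} -> {homo h : x y / x <= y} ->
  cancel g h -> cancel h g -> Filt_E L F -> Filt_E L (g @^-1` F).
Proof.
move=> gm hm gK hK [[F1 Fup FI] Fe].
have gle x y : (g x <= y) = (x <= h y).
  by apply/idP/idP => [/hm|/gm]; rewrite ?gK ?hK.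
have leg x y : (x <= g y) = (h x <= y).
  by apply/idP/idP => [/hm|/gm]; rewrite ?gK ?hK.
have gmeet A : g (bigmeet A) = bigmeet (g @` A).
  apply/le_anti; rewrite leg; apply/andP; split.
    by apply: bigmeet_glb => _ [a Aa <-]; apply/gm/bigmeet_lb.
  by apply: bigmeet_glb => a Aa; rewrite -leg bigmeet_lb //; exists a.
have gU x y : g (x `|` y) = g x `|` g y.
  apply/le_anti; rewrite gle !leUx -!gle leUl leUr /=.
  by rewrite !gm ?leUl ?leUr.
have gI x y : g (x `&` y) = g x `&` g y.
  apply/le_anti; rewrite leg !lexI -!leg leIl leIr andbT.
  by rewrite !gm ?leIl ?leIr.
split; first split=> [|x y /= Fx xy|x y /= Fx Fy].
- rewrite /preimage /= (_ : g \top = \top) //.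
  by apply/le_anti; rewrite lex1 leg lex1.
- exact: Fup Fx (gm _ _ xy).
- by rewrite gI; apply: FI.
move=> A AF Ae; rewrite /preimage /= gmeet; apply: Fe => [_ [a Aa <-]|b].
  exact: AF.
rewrite -gmeet -[b]hK -gU Ae gmeet !image_comp; congr bigmeet.
by apply: eq_imagel => a _ /=; rewrite gU hK.
Qed.

(** The filters of j are the inverse images of those of i under the
    automorphism of L induced by the isomorphism. *)
Lemma raney_iso_trace d (L : frameType d) d1 (C : coframeType d1)
    d2 (D : coframeType d2) (i : L -> C) (j : L -> D) :
  raney_extension i -> raney_extension j -> raney_isomorphic i j ->
  (forall c, Filt_E L (trace i c)) -> forall c, Filt_E L (trace j c).
Proof.
move=> [imono _ _ _ _] [jmono _ _ _ _] [f [f' [fR f'R fK f'K]]] iE c.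
case: fR f'R => fC [g [gF fg]] [f'C [g' [g'F f'g']]].
have gK : cancel g g'.
  by move=> x; apply: (mono_inj lexx le_anti imono); rewrite -f'g' -fg fK.
have g'K : cancel g' g.
  by move=> x; apply: (mono_inj lexx le_anti jmono); rewrite -fg -f'g' f'K.
have -> : trace j c = g' @^-1` trace i (f' c).
  apply/seteqP; split=> x; rewrite /trace /preimage /= -f'g'.
    exact: coframe_map_homo.
  by move=> /(coframe_map_homo fC); rewrite !f'K.
by apply: Filt_E_preimage g'K gK _ => //; exact: frame_map_homo.
Qed.

(** * Raney extensions built from classes of filters *)

(** The collections of filters that arise from Raney extensions of L as the
    sets of all their [trace c].  Closure under residuals, that is under
    implication by principal filters in the frame of filters, is what gives
    the coframe law. *)
Record raney_class d (L : frameType d) := RaneyClass {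
  raney_filters :> set (set L);
  raney_filters_SE : raney_filters `<=` Filt_SE L;
  raney_filters_bigcap : forall X : set (set L), X `<=` raney_filters ->
    raney_filters (\bigcap_(F in X) F);
  raney_filters_residual : forall F x, raney_filters F ->
    raney_filters [set y | F (y `|` x)];
  raney_filters_principal : forall x, raney_filters [set y | x <= y] }.

Record filter_of d (L : frameType d) (K : raney_class L) := FilterOf {
  filter_set :> set L;
  filter_ofP : `[< raney_filters K filter_set >] }.

HB.instance Definition _ d (L : frameType d) (K : raney_class L) :=
  [isSub for @filter_set d L K].
HB.instance Definition _ d (L : frameType d) (K : raney_class L) :=
  [Choice of filter_of K by <:].

Section RaneyClassCoframe.
Context d (L : frameType d) (K : raney_class L).
Implicit Types (F G : filter_of K) (X : set (filter_of K)).

(** Reverse inclusion, so that the principal filters of L embed L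
    covariantly. *)
Definition filter_le F G := `[< (G : set L) `<=` F >].

Lemma filter_le_refl : reflexive filter_le.
Proof. by move=> F; apply/asboolP. Qed.

Lemma filter_le_anti : antisymmetric filter_le.
Proof.
move=> F G /andP [/asboolP GF /asboolP FG]; apply: val_inj.
exact/seteqP.
Qed.

Lemma filter_le_trans : transitive filter_le.
Proof.
move=> G F H /asboolP FG /asboolP GH; apply/asboolP.
exact: subset_trans FG.
Qed.

HB.instance Definition _ :=
  Order.Le_isPOrder.Build set_display (filter_of K)
    filter_le_refl filter_le_anti filter_le_trans.

Lemma le_filter F G : F <= G <-> (G : set L) `<=` F.
Proof. by split=> /asboolP. Qed.

Definition mk_filter (S : set L) (KS : raney_filters K S) : filter_of K :=
  FilterOf (asboolT KS).

Lemma mem_class F : raney_filters K F.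
Proof. exact/asboolP/filter_ofP. Qed.

Lemma ex_filter_inf X : infimums X !=set0.
Proof.
pose Y := [set H : set L | raney_filters K H /\
                           forall F, X F -> (F : set L) `<=` H].
have KY : raney_filters K (\bigcap_(H in Y) H).
  by apply: raney_filters_bigcap => H [].
exists (mk_filter KY); split=> [F XF|G GX]; apply/le_filter => x /=.
  by move=> Fx H [_ XH]; apply: XH XF _ Fx.
by apply; split=> [|F XF]; [exact: mem_class|apply/le_filter/GX].
Qed.

HB.instance Definition _ :=
  POrder_isComplete.Build set_display (filter_of K)
    ex_filter_inf.

Lemma mem_bigjoin_filter X x :
  filter_set (bigjoin X) x <-> forall F, X F -> filter_set F x.
Proof.
split=> [Xx F XF|Xx].
  by have /le_filter := bigjoin_ub XF; apply.
have KX : raney_filters K (\bigcap_(S in [set (F : set L) | F in X]) S).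
  by apply: raney_filters_bigcap => _ [F _ <-]; apply: mem_class.
have /le_filter : bigjoin X <= mk_filter KX.
  apply: bigjoin_lub => F XF; apply/le_filter => y /= yX.
  by apply: yX; exists F.
by apply => _ /= [F XF <-]; apply: Xx.
Qed.

Lemma mem_join_filter F G x :
  filter_set F x -> filter_set G x -> filter_set (F `|` G) x.
Proof.
move=> Fx Gx.
have KFG : raney_filters K
    (\bigcap_(S in [set filter_set F; filter_set G]) S).
  by apply: raney_filters_bigcap => _ [] ->; apply: mem_class.
have /le_filter : F `|` G <= mk_filter KFG.
  rewrite leUx; apply/andP.
  by split; apply/le_filter => y /=; apply; [left|right].
by apply => _ /= [] ->.
Qed.

(** Joins are intersections and M is the least member of the class that
    contains every intersection of F with a G in X.  For x in F, the residual
    of M by x is in the class and contains every such G, hence also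
    [bigmeet X]; so if x is moreover in [bigmeet X], then x v x is in M. *)
Lemma filter_join_bigmeet F X :
  F `|` bigmeet X = bigmeet [set F `|` G | G in X].
Proof.
apply/le_anti/andP; split.
  by apply: bigmeet_glb => _ [G XG <-]; apply: leU2 => //; apply: bigmeet_lb.
set M := bigmeet [set _ | _ in _].
apply/le_filter => x FXx.
have Fx : filter_set F x by have /le_filter := leUl F (bigmeet X); apply.
have Xx : filter_set (bigmeet X) x.
  by have /le_filter := leUr (bigmeet X) F; apply.
have KM := raney_filters_residual x (mem_class M).
have /le_filter : mk_filter KM <= bigmeet X.
  apply: bigmeet_glb => G XG; apply/le_filter => y Gy /=.
  have /le_filter : M <= F `|` G by apply: bigmeet_lb; exists G.
  have up (H : filter_of K) :
      forall y z, filter_set H y -> y <= z -> filter_set H z.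
    by case: (raney_filters_SE (mem_class H)) => [[_ up _] _].
  apply; apply: mem_join_filter; first exact: up Fx (leUr _ _).
  exact: up Gy (leUl _ _).
by move=> /(_ _ Xx) /=; rewrite joinxx.
Qed.

HB.instance Definition _ :=
  CompleteLattice_isCoframe.Build set_display (filter_of K)
    filter_join_bigmeet.

Definition principal (x : L) : filter_of K :=
  mk_filter (raney_filters_principal K x).

Lemma le_principal F x : (F <= principal x) <-> filter_set F x.
Proof.
have [[_ up _] _] := raney_filters_SE (mem_class F).
split=> [/le_filter /(_ x (lexx x))|Fx] //.
by apply/le_filter => y /=; apply: up.
Qed.

Lemma principal_raney : raney_extension principal.
Proof.
have SE F := raney_filters_SE (mem_class F).
have imono : {mono principal : x y / x <= y}.
  by move=> x y; apply/idP/idP => [/le_principal|xy] //; apply/le_principal.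
split=> //.
- move=> F; exists F; apply/le_anti/andP; split.
    by apply: bigmeet_glb => _ [x Fx <-]; apply/le_principal.
  apply/le_filter => x Fx; apply/le_principal; apply: bigmeet_lb.
  by exists x.
- move=> A; apply/le_anti/andP; split; last first.
    by apply: bigjoin_lub => _ [a Aa <-]; rewrite imono bigjoin_ub.
  apply/le_filter => x /mem_bigjoin_filter xA /=; apply: bigjoin_lub => a Aa.
  by rewrite -imono; apply/le_principal; apply: xA; exists a.
- split.
    apply/le_anti; rewrite lex1 /=; apply/le_principal.
    by have [[]] := SE \top.
  move=> x y; apply/le_anti; rewrite lexI !imono leIl leIr /=.
  apply/le_principal; have [[_ _ FI] _] := SE (principal x `&` principal y).
  by apply: FI; apply/le_principal; rewrite ?leIl ?leIr.
move=> A Ase; apply/le_anti/andP; split.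
  by apply: bigmeet_glb => _ [a Aa <-]; rewrite imono bigmeet_lb.
apply/le_principal; have [_] := SE (bigmeet (principal @` A)); apply=> // a Aa.
by apply/le_principal/bigmeet_lb; exists a.
Qed.

Lemma trace_principal F : trace principal F = F.
Proof. by apply/seteqP; split=> x /le_principal. Qed.

End RaneyClassCoframe.

(** * Uniqueness of the Raney extension *)

Section ExtremeClasses.
Context d (L : frameType d).
Implicit Types (X : set (set L)) (F : set L) (x : L).

Lemma lattice_filter_bigcap X :
  X `<=` @lattice_filter _ L -> lattice_filter (\bigcap_(F in X) F).
Proof.
move=> Xf; split=> [F XF|x y Xx xy F XF|x y Xx Xy F XF];
  have [F1 up FI] := Xf _ XF => //.
- exact: up (Xx _ XF) xy.
- by apply: FI; [apply: Xx|apply: Xy].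
Qed.

Lemma lattice_filter_residual F x :
  lattice_filter F -> lattice_filter [set y | F (y `|` x)].
Proof.
move=> [F1 up FI]; split=> /= [|y z Fy yz|y z Fy Fz]; first by rewrite join1x.
  by apply: up Fy _; rewrite leU2.
apply: up (FI _ _ Fy Fz) _.
rewrite meet_join_le (leIxr _ (leUr _ _)) andbT meetC meet_join_le.
by rewrite meetC leUl (leIxr _ (leUr _ _)).
Qed.

Lemma Filt_E_bigcap X : X `<=` Filt_E L -> Filt_E L (\bigcap_(F in X) F).
Proof.
move=> XE; split; first by apply: lattice_filter_bigcap => F /XE [].
by move=> A AX Ae F XF; have [_] := XE _ XF; apply=> // a /AX; apply.
Qed.

Lemma Filt_SE_bigcap X : X `<=` Filt_SE L -> Filt_SE L (\bigcap_(F in X) F).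
Proof.
move=> XE; split; first by apply: lattice_filter_bigcap => F /XE [].
by move=> A AX Ae F XF; have [_] := XE _ XF; apply=> // a /AX; apply.
Qed.

Lemma Filt_E_residual F x : Filt_E L F -> Filt_E L [set y | F (y `|` x)].
Proof.
move=> [Ff Fe]; split; first exact: lattice_filter_residual.
move=> A AF Ae /=; rewrite Ae; apply: Fe; last exact: exact_join.
by move=> _ [a /AF ? <-].
Qed.

Lemma Filt_SE_residual F x : Filt_SE L F -> Filt_SE L [set y | F (y `|` x)].
Proof.
move=> [Ff Fe]; split; first exact: lattice_filter_residual.
move=> A AF Ae /=; rewrite (strongly_exact_exact Ae).
apply: Fe; last exact: strongly_exact_join.
by move=> _ [a /AF ? <-].
Qed.

Lemma Filt_E_principal x : Filt_E L [set y | x <= y].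
Proof.
split=> [|A Ax _]; first exact: lattice_filter_principal.
exact: bigmeet_glb.
Qed.

Definition exact_class : raney_class L :=
  RaneyClass (@Filt_E_sub_SE _ L) Filt_E_bigcap Filt_E_residual
    Filt_E_principal.

Definition strongly_exact_class : raney_class L :=
  RaneyClass (@subset_refl _ (Filt_SE L)) Filt_SE_bigcap Filt_SE_residual
    (fun x => Filt_E_sub_SE (Filt_E_principal x)).

(** The unique extension is isomorphic to that of exact filters, so all its
    filters are exact; it is also isomorphic to that of strongly exact
    filters, where every strongly exact filter occurs. *)
Lemma unique_raney_Filt_E : has_unique_raney_extension L ->
  Filt_SE L `<=` Filt_E L.
Proof.
move=> [d' [C [i [iR iU]]]] F FSE.
have iE c : Filt_E L (trace i c).
  have jR := principal_raney exact_class.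
  have [f [f' [h h' fK f'K]]] := iU _ _ _ jR.
  apply: (raney_iso_trace jR iR) => [|G]; first by exists f', f.
  by rewrite trace_principal; apply: (mem_class G).
have kR := principal_raney strongly_exact_class.
pose G := mk_filter (FSE : raney_filters strongly_exact_class F).
rewrite -[F](trace_principal G).
exact: raney_iso_trace iR kR (iU _ _ _ kR) iE _.
Qed.

Lemma Filt_E_unique_raney : Filt_SE L `<=` Filt_E L ->
  has_unique_raney_extension L.
Proof.
move=> SEE; have kR := principal_raney strongly_exact_class.
exists _, _, (principal strongly_exact_class); split=> // d' D j jR.
exact: raney_iso_of_Filt_E.
Qed.

End ExtremeClasses.

Theorem proposition4p15 (d : Order.disp_t) (L : frameType d) :
  subfit L ->
  [<-> scattered L;
       Filt_SE L = Filt_E L /\ Filt_E L = Filt_R L;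
       Filt_SE L = Filt_E L;
       has_unique_raney_extension L;
       S_open L = S_closed L;
       sole_raney_extension (open_sublocale L)].
Proof.
move=> sL.
have regularE : Filt_SE L `<=` Filt_R L ->
    Filt_SE L = Filt_E L /\ Filt_E L = Filt_R L.
  move=> SER; split; apply/seteqP; split.
  - by move=> F /SER /Filt_R_sub_E.
  - exact: Filt_E_sub_SE.
  - exact: subfit_Filt_E_sub_R.
  - exact: Filt_R_sub_E.
have regular : Filt_SE L `<=` Filt_E L -> Filt_SE L `<=` Filt_R L.
  by move=> SEE F /SEE; apply: subfit_Filt_E_sub_R.
have closedT : scattered L -> S_closed L = setT.
  move=> sc; apply/seteqP; split=> // S _.
  by exists [set a | closed_sublocale L a <= S];
    rewrite // -(scattered_closed_generated sL sc).
have fitted : Filt_SE L `<=` Filt_R L ->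
    forall S : sublocale L, S = bigmeet (open_sublocale L @` fixing S).
  by move=> /closed_fitted; apply: all_fitted.
tfae.
- by move=> sc; apply/regularE/regular_of_open_closed; rewrite closedT.
- by case.
- by move=> SEE; apply: Filt_E_unique_raney; rewrite SEE.
- move=> /unique_raney_Filt_E /regular SER.
  rewrite (closedT (scattered_of_regular SER)); apply/seteqP; split=> // S _.
  by exists (fixing S); rewrite // -(fitted SER).
- move=> oc; have SER : Filt_SE L `<=` Filt_R L.
    by apply: regular_of_open_closed; rewrite oc.
  have oR := open_raney (fitted SER); split=> // d' D j jR.
  by apply: raney_iso_of_Filt_E => //; rewrite (regularE SER).1.
move=> oR; apply/scattered_of_regular/regular/unique_raney_Filt_E.
by exists _, _, (open_sublocale L).
Qed.
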